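(* Let $K$ be a Polish space, $(\varphi_j)$ a sequence in $\mathrm{DSC}(K)$, and $f:K\to\mathbb{R}$ a function such that (i) $\sum\varphi_j$ converges locally uniformly to $f$, and (ii) $\sum\mathrm{osc}_\alpha\varphi_j$ converges locally uniformly, for every ordinal $\alpha<\omega_1$. Then $f\in \mathrm{DSC}(K)$.
   Context: $C(K)$ is the class of continuous functions $K\to\mathbb{R}$. $\mathrm{DSC}(K)$ is the set of $f:K\to\mathbb{R}$ for which there is a sequence $(f_n)\subset C(K)$ with $f_n\to f$ pointwise and $\sum_{n=1}^\infty|f_{n+1}(k)-f_n(k)|<\infty$ for every $k\in K$ (equivalently, the differences of two real-valued semi-continuous functions on $K$). A series $\sum g_j$ of $\mathbb{R}\cup\{\infty\}$-valued functions on $K$ converges locally uniformly if for every $x\in K$ there are a neighborhood $U$ of $x$ and an integer $\nu$ such that $g_j|_U$ is real-valued for all $j\ge\nu$ and $\sum_{j\ge\nu}g_j$ converges uniformly on $U$; in (i), ''to $f$'' means that $f$ is the pointwise sum of the series. Transfinite oscillations: for $g:K\to[-\infty,\infty]$ and $x\in K$, $\limsup_{y\to x}g(y)$ denotes the unrestricted limsup $\inf_V\sup g(V)$, the infimum over all open neighborhoods $V$ of $x$ (so $y=x$ is allowed), and the upper semi-continuous envelope of $g$ is $\mathbf{U}g(x)=\limsup_{y\to x}g(y)$. For $h:K\to\mathbb{R}$ define $\mathrm{osc}_\alpha h:K\to[0,\infty]$ for ordinals $\alpha<\omega_1$ by induction: $\mathrm{osc}_0h\equiv0$; if $\beta=\alpha+1$,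 put $\widetilde{\mathrm{osc}}_\beta h(x)=\limsup_{y\to x}\big(|h(y)-h(x)|+\mathrm{osc}_\alpha h(y)\big)$ for all $x\in K$; if $\beta$ is a limit ordinal, put $\widetilde{\mathrm{osc}}_\beta h=\sup_{\alpha<\beta}\mathrm{osc}_\alpha h$; in both cases $\mathrm{osc}_\beta h=\mathbf{U}\,\widetilde{\mathrm{osc}}_\beta h$. *)

(* Defs.v *)
From HB Require Import structures.
From mathcomp Require Import all_boot all_order all_algebra.
From mathcomp Require Import all_classical all_reals all_analysis wochoice.

Set Implicit Arguments.
Unset Strict Implicit.
Unset Printing Implicit Defensive.

Import Order.TTheory GRing.Theory Num.Theory.
Import numFieldNormedType.Exports.

Local Open Scope classical_set_scope.
Local Open Scope ring_scope.

(* Separable and metrizable, as a topological space, by some complete metric;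
   [K] itself carries no distinguished metric. *)
Definition polish (R : realType) (K : topologicalType) : Prop :=
  exists d : K -> K -> R,
    [/\ [/\ (forall x y, d x y = 0 <-> x = y),
            (forall x y, d x y = d y x) &
            (forall x y z, d x z <= d x y + d y z)],
        (forall (x : K) (A : set K),
            nbhs x A <-> exists2 e : R, 0 < e & [set y | d x y < e] `<=` A),
        (forall u : nat -> K,
            (forall e : R, 0 < e ->
               exists N : nat, forall m n : nat, (N <= m)%N -> (N <= n)%N ->
                 d (u m) (u n) < e) ->
            exists l : K, u @ \oo --> l) &
        (exists2 D : set K, countable D & dense D)].

Definition DSC (R : realType) (K : topologicalType) (f : K -> R) : Prop :=
  exists F : nat -> K -> R,
    [/\ forall n, continuous (F n),
        forall k, F n k @[n --> \oo] --> f k &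
        forall k, cvgn (series (fun n => `|F n.+1 k - F n k|))].

Definition locally_uniformly_convergent (R : realType) (K : topologicalType)
    (g : nat -> K -> \bar R) : Prop :=
  forall x : K, exists U : set K, exists nu : nat,
    [/\ nbhs x U,
        (forall j y, (nu <= j)%N -> U y -> g j y \is a fin_num) &
        exists s : K -> R,
          {uniform U,
            (fun n (y : K) => \sum_(nu <= j < n) fine (g j y)) @ \oo --> s}].

Section TransfiniteOscillation.
Context (R : realType) (K : topologicalType).

(* The filter [nbhs x] includes [x] itself, so the limsup is unrestricted. *)
Definition usc_envelope (g : K -> \bar R) : K -> \bar R :=
  fun x => limf_esup g (nbhs x).

Context (W : eqType) (le : rel W).

Definition wlt (a b : W) : bool := (a != b) && le a b.

Definition wsucc (a b : W) : Prop :=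
  wlt a b /\ ~ exists c, wlt a c /\ wlt c b.

Lemma wlt_wf : well_order le -> well_founded wlt.
Proof.
move=> wo; have wot : wo_chain le predT by move=> A _; exact: wo.
have anti := wo_chain_antisymmetric wot.
move=> a; apply: contrapT => na.
have [|b [[/asboolP nb bmin] _]] := wo (fun c => `[< ~ Acc wlt c >]).
  by exists a; apply/asboolP.
apply: nb; constructor => c /andP[cb lecb]; apply: contrapT => nc.
have lebc : le b c by apply: bmin; apply/asboolP.
by move/eqP: cb; apply; apply: anti => //; rewrite lecb lebc.
Qed.

(* Recursion step at [b]; only the values of [prev] below [b] are used.  The
   case of the least element is separate because [ereal_sup set0] is -oo. *)
Definition osc_step (h : K -> R) (b : W) (prev : W -> K -> \bar R) :
    K -> \bar R :=
  match pselect (exists a, wsucc a b) with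
  | left ex =>
      let a := sval (cid ex) in
      usc_envelope (fun x =>
        limf_esup (fun y => (`|h y - h x|%:E + prev a y)%E) (nbhs x))
  | right _ =>
      if `[< exists a, wlt a b >] then
        usc_envelope (fun x => ereal_sup [set prev a x | a in [set a | wlt a b]])
      else fun=> 0%E
  end.

(* A countable ordinal is presented as an element [b] of a well-ordered type
   whose set of predecessors is countable; the ordinal it denotes is the order
   type of that set of predecessors. *)
Definition osc (wo : well_order le) (h : K -> R) : W -> K -> \bar R :=
  Fix (wlt_wf wo) (fun=> K -> \bar R)
    (fun b rec => osc_step h b (fun a =>
       match pselect (wlt a b) with
       | left ab => rec a ab
       | right _ => fun=> 0%E
       end)).

Variables (wo : well_order le) (h : K -> R).

Let wlt_wo_le a b : le a b = (a == b) || wlt a b.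
Proof.
rewrite /wlt; case: eqVneq => //= ->.
have wot : wo_chain le predT by move=> A _; exact: wo.
by apply: (wo_chain_reflexive wot).
Qed.

Let wsucc_uniq a a' b : wsucc a b -> wsucc a' b -> a = a'.
Proof.
move=> [ab na] [a'b na'].
have wot : wo_chain le predT by move=> A _; exact: wo.
have := @wo_chainW _ _ _ wot a a' isT isT.
rewrite !wlt_wo_le => /orP[] /orP[/eqP //|lt].
  by case: na; exists a'.
by case: na'; exists a.
Qed.

Let osc_unfold b :
  osc wo h b = osc_step h b (fun a => if wlt a b then osc wo h a else fun=> 0%E).
Proof.
rewrite {1}/osc Fix_eq; last first.
  move=> a f g fg; congr osc_step; apply/funext => c.
  by case: (pselect (wlt c a)) => // ca; rewrite fg.
congr osc_step; apply/funext => c.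
case: (pselect (wlt c b)) => [cb|/negP/negbTE ->//].
by rewrite ifT.
Qed.

Lemma osc0 b : ~ (exists a, wlt a b) -> osc wo h b = fun=> 0%E.
Proof.
move=> nb; rewrite osc_unfold /osc_step; case: pselect => [ex|_].
  by case: nb; case: ex => a [ab _]; exists a.
by case: asboolP.
Qed.

Lemma oscS a b : wsucc a b -> osc wo h b =
  usc_envelope (fun x =>
    limf_esup (fun y => (`|h y - h x|%:E + osc wo h a y)%E) (nbhs x)).
Proof.
move=> sab; rewrite osc_unfold /osc_step; case: pselect => [ex|[]]; last first.
  by exists a.
case: cid => a' /= sa'b; rewrite -(wsucc_uniq sab sa'b).
by case: sab => -> _.
Qed.

Lemma osc_lim b : (exists a, wlt a b) -> ~ (exists a, wsucc a b) ->
  osc wo h b =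
  usc_envelope (fun x =>
    ereal_sup [set osc wo h a x | a in [set a | wlt a b]]).
Proof.
move=> nb ns; rewrite osc_unfold /osc_step; case: pselect => // _.
case: asboolP => // _; congr usc_envelope; apply/funext => x.
by congr ereal_sup; apply: eq_imagel => a /= ->.
Qed.

End TransfiniteOscillation.

(* Main.v *)
Require Import Defs.
From HB Require Import structures.
From mathcomp Require Import all_boot all_order all_algebra.
From mathcomp Require Import all_classical all_reals all_analysis wochoice.
From mathcomp Require Import lra.

Import Order.TTheory GRing.Theory Num.Theory.
Import numFieldNormedType.Exports.

Local Open Scope classical_set_scope.
Local Open Scope ring_scope.

(** The idea is that a function [S] is locally a difference of semicontinuous
    functions as soon as its oscillation is dominated, in the sense that some
    real function [G] satisfies
      limsup_(y -> x) (G y + |S y - S x|) <= G x    for all [x];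
    then [G + S] and [G - S] are both upper semicontinuous and [S] is half their
    difference.  Such a domination is additive and survives uniform limits
    ([osc_bound_series]), which is what makes a series of functions tractable.

    The dominating functions come from the transfinite oscillations.  On a space
    with a countable base the family [osc_alpha (phi j)] is nondecreasing in
    [alpha] and upper semicontinuous, so for some countable ordinal [g], the same
    for all [j], it no longer changes after [g] ([osc_stationary]).  Then
    [osc_(g+1) (phi j) = osc_g (phi j)], and the definition of the successor step
    says precisely that [osc_g (phi j)] dominates the oscillation of [phi j],
    wherever it is finite.  The hypothesis on the series of oscillations is
    needed at this single [g]: near any point, a tail of the series of the
    [phi j] has a sum [S] dominated by the sum of the same tail of the
    [osc_g (phi j)], so that [f] is near this point the sum of finitely many
    [phi j] and of [S].  Countable ordinals are taken in a well-ordering of the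
    uncountable set of all sets of natural numbers.

    Two facts turn this into the statement.  A nonnegative lower semicontinuous
    function on an open subset of a metric space is an increasing limit of
    Lipschitz functions ([lsc_DSC_on]), which settles the local problem; and the
    local approximations patch together along a countable cover by cozero sets
    ([DSC_local]). *)

(** * Countable ordinals in an uncountable well-ordered type *)

Lemma countable_setU1 {T : Type} (A : set T) (x : T) :
  countable A -> countable (A `|` [set x]).
Proof.
move=> cA; rewrite -bigcup2E; apply: bigcup_countable => // -[|[|i]] _ /=.
- exact: cA.
- exact: countable1.
- exact: countable0.
Qed.

Section WellOrder.
Context {W : eqType} {le : rel W} (wo : well_order le).

Lemma well_order_least (P : W -> Prop) :
  (exists a, P a) -> exists z, P z /\ forall a, P a -> le z a.
Proof.
move=> [a Pa]; have [|z [[/asboolP Pz zmin] _]] := wo (fun c => `[< P c >]).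
  by exists a; apply/asboolP.
by exists z; split=> // b Pb; apply: zmin; apply/asboolP.
Qed.

Lemma well_order_chain : wo_chain le predT.
Proof. by move=> A _; exact: wo. Qed.

Lemma well_order_refl a : le a a.
Proof. exact: (wo_chain_reflexive well_order_chain). Qed.

Lemma well_order_anti a b : le a b -> le b a -> a = b.
Proof.
by move=> ab ba; apply: (wo_chain_antisymmetric well_order_chain) => //;
  rewrite ab.
Qed.

Lemma well_order_total a b : le a b \/ le b a.
Proof. by apply/orP; exact: (wo_chainW well_order_chain). Qed.

Lemma wlt_le a b : wlt le a b -> le a b.
Proof. by case/andP. Qed.

Lemma well_order_leP a b : ~ le b a -> wlt le a b.
Proof.
move=> nba; apply/andP; split; last by case: (well_order_total a b).
by apply/eqP => eab; apply: nba; rewrite eab; exact: well_order_refl.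
Qed.

Lemma wltN a b : wlt le a b -> ~ le b a.
Proof.
by case/andP => /eqP nab leab leba; apply: nab; exact: well_order_anti.
Qed.

(** The element [a] denotes a countable ordinal: it has countably many
    predecessors ([a] itself is counted here, which is immaterial). *)
Definition countable_ordinal (a : W) := countable [set b | le b a].

Hypothesis W_uncountable : ~ countable [set: W].

Lemma countable_ordinals_uncountable :
  ~ countable [set a | countable_ordinal a].
Proof.
move=> cC; apply: W_uncountable.
have [[w nw]|allC] := pselect (exists w, ~ countable_ordinal w); last first.
  apply: sub_countable cC; apply: subset_card_le => a _ /=.
  by apply: contrapT => na; apply: allC; exists a.
(* The least element outside a countable set of countable ordinals would have
   countably many predecessors. *)
have [z [nz zmin]] := well_order_least (fun w => ~ countable_ordinal w)
  (ex_intro _ w nw).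
case: nz; have : countable ([set a | countable_ordinal a] `|` [set z]).
  exact: countable_setU1.
apply: sub_countable; apply: subset_card_le => a /= az.
have [->|/eqP naz] := eqVneq a z; first by right.
left; apply: contrapT => na; apply: naz; apply: well_order_anti => //.
exact: zmin.
Qed.

(** Otherwise the countable ordinals would all lie in the union of the countable
    sets of predecessors of the [A i]. *)
Lemma countable_ordinal_sup (I : countType) (A : I -> W) :
  (forall i, countable_ordinal (A i)) ->
  exists2 g, countable_ordinal g & forall i, le (A i) g.
Proof.
move=> cA; apply: contrapT => nex; apply: countable_ordinals_uncountable.
have : countable (\bigcup_i [set b | le b (A i)]).
  by apply: bigcup_countable => [|i _]; [exact: countableP|exact: cA].
apply: sub_countable; apply: subset_card_le => a /= ca.
apply: contrapT => na; apply: nex; exists a => // i.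
have [//|] := well_order_total (A i) a.
by move=> aAi; case: na; exists i.
Qed.

Lemma countable_ordinal_succ a :
  countable_ordinal a -> exists2 s, countable_ordinal s & wsucc le a s.
Proof.
move=> ca; have [|s [as_ smin]] := well_order_least (wlt le a).
  apply: contrapT => nex; apply: W_uncountable.
  apply: sub_countable ca; apply: subset_card_le => b _ /=.
  by apply: contrapT => nb; apply: nex; exists b; exact: well_order_leP.
exists s; last first.
  by split=> // -[c [ac cs]]; exact: wltN cs (smin c ac).
have : countable ([set b | le b a] `|` [set s]).
  exact: countable_setU1.
apply: sub_countable; apply: subset_card_le => b /= bs.
have [->|/eqP nbs] := eqVneq b s; first by right.
left; apply: contrapT => nba; apply: nbs; apply: well_order_anti => //.
by apply: smin; exact: well_order_leP.
Qed.

End WellOrder.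

(** Cantor's diagonal argument. *)
Lemma set_nat_uncountable : ~ countable [set: set nat].
Proof.
move=> /countable_injP[f finj].
have [] := pselect (exists2 A, f A = f [set n | exists2 A, f A = n & ~ A n] &
  ~ A (f [set n | exists2 A, f A = n & ~ A n])).
  move=> h; have [A fA nA] := h; apply: nA.
  by rewrite (finj _ _ _ _ fA) ?inE.
by move=> nh; apply: (nh); exists [set n | exists2 A, f A = n & ~ A n].
Qed.

(** * Upper limits and transfinite oscillations *)

Section Limsup.
Context {R : realType} {K : topologicalType}.

Lemma limf_esup_ge_at (g : K -> \bar R) (x : K) :
  (g x <= limf_esup g (nbhs x))%E.
Proof.
rewrite limf_esupE; apply: le_ereal_inf_tmp => _ [V xV <-].
by apply: ereal_sup_ubound; exists x => //; exact: nbhs_singleton.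
Qed.

Lemma limf_esup_lt (g : K -> \bar R) (x : K) (c : \bar R) :
  (limf_esup g (nbhs x) < c)%E -> \forall y \near x, (g y < c)%E.
Proof.
rewrite limf_esupE => /ereal_inf_lt[_ [V xV <-]] Vc.
apply: filterS xV => y Vy; apply: le_lt_trans Vc.
by apply: ereal_sup_ubound; exists y.
Qed.

(** Upper semicontinuity of an extended real valued function. *)
Definition eusc (g : K -> \bar R) : Prop :=
  forall x c, (g x < c)%E -> \forall y \near x, (g y < c)%E.

Lemma usc_envelope_eusc (g : K -> \bar R) : eusc (usc_envelope g).
Proof.
move=> x c; rewrite /usc_envelope limf_esupE.
move=> /ereal_inf_lt[_ [V xV <-]] Vc.
near=> y; apply: le_lt_trans Vc; apply: ereal_inf_lbound; exists V => //.
by near: y; exact: nbhs_interior.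
Unshelve. all: by end_near. Qed.

End Limsup.

Lemma ereal_rat_between {R : realType} (u v : \bar R) : (u < v)%E ->
  exists2 q : rat, (u < (ratr q : R)%:E)%E & ((ratr q : R)%:E < v)%E.
Proof.
have between (a b : R) : a < b -> exists2 q : rat, a < ratr q & ratr q < b.
  by move=> /rat_in_itvoo[q /andP[]]; exists q.
case: u => [a||]; case: v => [b||] //=.
- by rewrite lte_fin => /between[q aq qb]; exists q; rewrite lte_fin.
- have /between[q aq _] : a < a + 1 by rewrite ltrDl.
  by exists q; rewrite ?lte_fin ?ltry.
- have /between[q _ qb] : b - 1 < b by rewrite gtrBl.
  by exists q; rewrite ?lte_fin ?ltNyr.
- by exists 0; rewrite ?ltNyr ?ltry.
Qed.

Section Oscillation.
Context {R : realType} {K : topologicalType} {W : eqType} {le : rel W}.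
Context (wo : well_order le) (h : K -> R).

Lemma osc_eusc b : eusc (osc wo h b).
Proof.
have [[a sab]|ns] := pselect (exists a, wsucc le a b).
  by rewrite (oscS wo h sab); exact: usc_envelope_eusc.
have [lt|nb] := pselect (exists a, wlt le a b).
  by rewrite (osc_lim wo h lt ns); exact: usc_envelope_eusc.
by rewrite (osc0 wo h nb) => x c c0; apply: nearW.
Qed.

(** The value of the successor step before the upper semicontinuous envelope is
    taken is a lower bound. *)
Lemma osc_succ_ge a b x : wsucc le a b ->
  (limf_esup (fun y => `|h y - h x|%:E + osc wo h a y) (nbhs x)
    <= osc wo h b x)%E.
Proof. by move=> sab; rewrite (oscS wo h sab); exact: limf_esup_ge_at. Qed.

(** At a successor, the value of the limsup at [y = x] is already at least the
    previous oscillation. *)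
Lemma osc_le a b x : le a b -> (osc wo h a x <= osc wo h b x)%E.
Proof.
elim/(well_founded_ind (wlt_wf wo)) : b => b IH in a *.
have [->//|nab] := eqVneq a b; move=> leab.
have lab : wlt le a b by rewrite /wlt nab.
have [[c scb]|ns] := pselect (exists c, wsucc le c b).
  have cb := scb.1; apply: le_trans (osc_succ_ge _ _ x scb).
  apply: le_trans (limf_esup_ge_at _ x); rewrite subrr normr0 add0e.
  apply: IH => //; have [//|ca] := well_order_total wo a c.
  have [->|nca] := eqVneq c a; first exact: well_order_refl.
  by case: scb.2; exists a; split=> //; rewrite /wlt nca.
rewrite (osc_lim wo h _ ns); last by exists a.
apply: le_trans (limf_esup_ge_at _ x).
by apply: ereal_sup_ubound; exists a.
Qed.

End Oscillation.

(** On a space with a countable base, the oscillations of a sequence of functions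
    all become stationary, at every point, from a common countable ordinal [g]
    on.  For a function [phi j], a basic open set and a rational [q], either the
    oscillations of all countable orders stay below [q] on that set, or this fails
    from some threshold on; any [g] above these countably many thresholds will
    do, since two different values at orders [g] and [s] would be separated by
    some [q] on some basic set, by upper semicontinuity. *)
Lemma osc_stationary {R : realType} {K : topologicalType} {W : eqType}
    {le : rel W} (wo : well_order le) (phi : nat -> K -> R)
    (B : nat -> set K)
    (Bbase : forall (x : K) (A : set K), nbhs x A ->
      exists2 n, nbhs x (B n) & B n `<=` A) :
  ~ countable [set: W] ->
  exists2 g, countable_ordinal (le := le) g &
  forall s, countable_ordinal (le := le) s -> le g s ->
  forall j x, osc wo (phi j) s x = osc wo (phi j) g x.
Proof.
move=> Wu.
pose below (i : nat * nat * rat) a :=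
  forall y, B i.1.2 y -> (osc wo (phi i.1.1) a y < (ratr i.2 : R)%:E)%E.
have [a0 ca0] : exists a0 : W, countable_ordinal (le := le) a0.
  apply: contrapT => nex; apply: (countable_ordinals_uncountable wo Wu).
  apply: sub_countable (countable0 W); apply: subset_card_le => a /= ca.
  by apply: nex; exists a.
(* [A i] is the threshold of [i], or [a0] when there is none. *)
have /choice[A PA] : forall i, exists a, countable_ordinal (le := le) a /\
    (below i a -> forall b, countable_ordinal (le := le) b -> below i b).
  move=> i; have [[a [ca na]]|nex] := pselect (exists a,
      countable_ordinal (le := le) a /\ ~ below i a).
    by exists a.
  exists a0; split=> // _ b cb; apply: contrapT => nb.
  by apply: nex; exists b.
have [g cg gA] := countable_ordinal_sup wo Wu _ A (fun i => (PA i).1).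
exists g => // s cs gs j x; apply/eqP.
rewrite eq_le (osc_le wo _ _ _ x gs) andbT.
rewrite leNgt; apply/negP => lt.
have [q gq qs] : exists2 q : rat, (osc wo (phi j) g x < (ratr q : R)%:E)%E &
    ((ratr q : R)%:E < osc wo (phi j) s x)%E.
  exact: ereal_rat_between.
have [n xB Bn] := Bbase _ _ (osc_eusc wo (phi j) g x _ gq).
have bg : below (j, n, q) g by move=> y /Bn.
have bA : below (j, n, q) (A (j, n, q)).
  move=> y By; apply: le_lt_trans (bg y By); exact: osc_le (gA _).
have := (PA (j, n, q)).2 bA s cs x (nbhs_singleton xB).
by rewrite ltNge (ltW qs).
Qed.

(** Where the oscillations at [g] and at its successor agree, the value at [g]
    dominates the oscillation of [h]. *)
Lemma osc_stationary_usc {R : realType} {K : topologicalType} {W : eqType}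
    {le : rel W} (wo : well_order le) (h : K -> R) (g s : W) (x : K)
    (c : \bar R) :
  wsucc le g s -> osc wo h s x = osc wo h g x ->
  (osc wo h g x < c)%E ->
  \forall y \near x, (`|h y - h x|%:E + osc wo h g y < c)%E.
Proof.
move=> sgs <- lt; apply: limf_esup_lt; apply: le_lt_trans lt.
exact: osc_succ_ge.
Qed.

(** * Pointwise absolutely convergent approximation on a set *)

Lemma is_cvg_series_bounded {R : realType} (u : nat -> R) (M : R) :
  (forall n, 0 <= u n) -> (forall n, series u n <= M) -> cvgn (series u).
Proof.
move=> u0 uM; apply: nondecreasing_is_cvgn; first exact: nondecreasing_series.
by exists M => _ [n _ <-].
Qed.

Lemma eq_from_is_cvg_series {R : realType} (u v : nat -> R) (N : nat) :
  (forall n, (N <= n)%N -> u n = v n) -> cvgn (series v) -> cvgn (series u).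
Proof.
move=> uv; rewrite -(is_cvg_series_restrict N v) -(is_cvg_series_restrict N u).
set s := (X in cvgn X -> _); set t := (X in _ -> cvgn X).
suff -> : s = t by [].
apply/funext => n; apply: eq_big_nat => i /andP[Ni _].
by rewrite uv.
Qed.

(** [DSC] relative to a set [V]: the approximants are continuous on the whole
    space, and only the convergence is localised to [V]. *)
Definition DSC_on {R : realType} {K : topologicalType} (V : set K)
    (f : K -> R) : Prop :=
  exists F : nat -> K -> R,
    [/\ forall n, continuous (F n),
        forall k, V k -> F n k @[n --> \oo] --> f k &
        forall k, V k -> cvgn (series (fun n => `|F n.+1 k - F n k|))].

Section DSCOn.
Context {R : realType} {K : topologicalType}.
Implicit Types (f g : K -> R) (V : set K).

Lemma DSC_DSC_on V f : DSC f -> DSC_on V f.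
Proof. by case=> F [cF Ff FV]; exists F; split. Qed.

Lemma DSC_on_eq V f g : (forall k, V k -> f k = g k) -> DSC_on V f -> DSC_on V g.
Proof.
move=> fg [F [cF Ff FV]]; exists F; split=> // k Vk.
by rewrite -fg //; exact: Ff.
Qed.

Lemma DSC_on_cst V (c : R) : DSC_on V (fun=> c).
Proof.
exists (fun _ _ => c); split.
- by move=> n k; exact: cvg_cst.
- by move=> k _; exact: cvg_cst.
- move=> k _; apply: (is_cvg_series_bounded _ 0) => // n.
  by rewrite /series /= big1 // => i _; rewrite subrr normr0.
Qed.

Lemma DSC_onD V f g : DSC_on V f -> DSC_on V g -> DSC_on V (fun k => f k + g k).
Proof.
move=> [F [cF Ff FV]] [G [cG Gg GV]]; exists (fun n k => F n k + G n k); split.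
- by move=> n k; apply: cvgD; [exact: cF|exact: cG].
- by move=> k Vk; apply: cvgD; [exact: Ff|exact: Gg].
- move=> k Vk; have := is_cvg_seriesD (FV k Vk) (GV k Vk).
  apply: series_le_cvg => n //; rewrite ?addr_ge0 //=.
  by rewrite opprD addrACA; exact: ler_normD.
Qed.

Lemma DSC_onN V f : DSC_on V f -> DSC_on V (fun k => - f k).
Proof.
move=> [F [cF Ff FV]]; exists (fun n k => - F n k); split.
- by move=> n k; apply: cvgN; exact: cF.
- by move=> k Vk; apply: cvgN; exact: Ff.
- move=> k Vk; under eq_fun do rewrite -opprD normrN; exact: FV.
Qed.

Lemma DSC_onZ V (c : R) f : DSC_on V f -> DSC_on V (fun k => c * f k).
Proof.
move=> [F [cF Ff FV]]; exists (fun n k => c * F n k); split.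
- by move=> n k; apply: cvgMr; exact: cF.
- by move=> k Vk; apply: cvgMr; exact: Ff.
- move=> k Vk; under eq_fun do rewrite -mulrBr normrM.
  exact: (is_cvg_seriesZ (FV k Vk)).
Qed.

Lemma DSC_on_sum V (phi : nat -> K -> R) n :
  (forall j, DSC_on V (phi j)) -> DSC_on V (fun k => \sum_(0 <= j < n) phi j k).
Proof.
move=> Hphi; elim: n => [|n IH].
  by apply: DSC_on_eq (DSC_on_cst V 0) => k _; rewrite big_geq.
apply: DSC_on_eq (DSC_onD _ _ _ IH (Hphi n)) => k _.
by rewrite big_nat_recr.
Qed.

End DSCOn.

(** * Metric spaces: Lipschitz approximation and countable bases *)

Section Metric.
Context {R : realType} {K : topologicalType} (d : K -> K -> R).
Hypothesis d_eq0 : forall x y, d x y = 0 <-> x = y.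
Hypothesis d_sym : forall x y, d x y = d y x.
Hypothesis d_triangle : forall x y z, d x z <= d x y + d y z.
Hypothesis d_nbhs : forall (x : K) (A : set K),
  nbhs x A <-> exists2 e : R, 0 < e & [set y | d x y < e] `<=` A.

Lemma dist_refl x : d x x = 0.
Proof. exact/d_eq0. Qed.

Lemma dist_ge0 x y : 0 <= d x y.
Proof. by have := d_triangle x y x; rewrite dist_refl (d_sym y x); lra. Qed.

Lemma dist_lipschitz_continuous (g : K -> R) (L : R) : 0 <= L ->
  (forall x y, g x <= g y + L * d x y) -> continuous g.
Proof.
move=> L0 gL x; apply/cvgrPdist_lt => e e0; apply/d_nbhs.
exists (e / (L + 1)); first by rewrite divr_gt0 // ltr_wpDl.
move=> y /=; rewrite ltr_pdivlMr ?ltr_wpDl // => dxy.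
have := gL x y; have := gL y x; rewrite (d_sym y x) => h1 h2.
have dL : L * d x y < e by have := dist_ge0 x y; nra.
by rewrite ltr_distl; apply/andP; split; lra.
Qed.

(** The [n]-Lipschitz regularisation (infimal convolution) of [p]. *)
Definition lipschitz_minorant (p : K -> R) (n : nat) (x : K) : R :=
  inf [set p y + n%:R * d x y | y in [set: K]].

Section Minorant.
Variable p : K -> R.
Hypothesis p_ge0 : forall x, 0 <= p x.

Lemma lipschitz_minorant_le n x y :
  lipschitz_minorant p n x <= p y + n%:R * d x y.
Proof.
apply: ge_inf; last by exists y.
by exists 0 => _ [z _ <-]; rewrite addr_ge0 ?mulr_ge0 ?dist_ge0.
Qed.

Lemma lipschitz_minorant_ge n x c :
  (forall y, c <= p y + n%:R * d x y) -> c <= lipschitz_minorant p n x.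
Proof.
move=> cp; apply: lb_le_inf; first by exists (p x + n%:R * d x x); exists x.
by move=> _ [y _ <-].
Qed.

Lemma lipschitz_minorant_continuous n : continuous (lipschitz_minorant p n).
Proof.
apply: (@dist_lipschitz_continuous _ n%:R) => // x y.
rewrite -lerBlDr; apply: lipschitz_minorant_ge => z.
rewrite lerBlDr; apply: le_trans (lipschitz_minorant_le n x z) _.
rewrite -addrA lerD2l -mulrDr ler_wpM2l //.
by rewrite addrC; exact: d_triangle.
Qed.

Lemma lipschitz_minorant_le_self n x : lipschitz_minorant p n x <= p x.
Proof.
by apply: le_trans (lipschitz_minorant_le n x x) _; rewrite dist_refl mulr0 addr0.
Qed.

Lemma lipschitz_minorant_ge0 n x : 0 <= lipschitz_minorant p n x.
Proof.
apply: lipschitz_minorant_ge => y.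
by rewrite addr_ge0 ?mulr_ge0 ?dist_ge0.
Qed.

Lemma lipschitz_minorant_nondecreasing n x :
  lipschitz_minorant p n x <= lipschitz_minorant p n.+1 x.
Proof.
apply: lipschitz_minorant_ge => y.
apply: le_trans (lipschitz_minorant_le n x y) _.
by rewrite lerD2l ler_wpM2r ?dist_ge0 // ler_nat.
Qed.

(** The regularisations converge to [p] at every point of lower
    semicontinuity. *)
Lemma lipschitz_minorant_cvg x :
  (forall c, c < p x -> \forall y \near x, c < p y) ->
  lipschitz_minorant p n x @[n --> \oo] --> p x.
Proof.
move=> lsc; apply/cvgrPdist_le => e e0.
have /lsc/d_nbhs[r r0 rp] : p x - e < p x by rewrite gtrBl.
near=> n.
rewrite ger0_norm ?subr_ge0 ?lipschitz_minorant_le_self // lerBlDr addrC -lerBlDr.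
apply: lipschitz_minorant_ge => y.
have [dr|rd] := ltP (d x y) r.
  apply: le_trans (ltW (rp y dr)) _.
  by rewrite lerDl mulr_ge0 ?dist_ge0.
(* far from [x] the penalty alone exceeds [p x] *)
have nr : p x / r <= n%:R by near: n; exact: nbhs_infty_ger.
rewrite ler_pdivrMr // in nr.
have nd : n%:R * r <= n%:R * d x y by rewrite ler_wpM2l.
by have := p_ge0 y; lra.
Unshelve. all: by end_near. Qed.

End Minorant.

(** Off [V] the function is replaced by [0], which preserves lower
    semicontinuity at the points of [V]. *)
Lemma lsc_DSC_on (V : set K) (p : K -> R) :
  (forall x, V x -> nbhs x V) -> (forall x, V x -> 0 <= p x) ->
  (forall x, V x -> forall c, c < p x -> \forall y \near x, c < p y) ->
  DSC_on V p.
Proof.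
move=> oV p0 lsc; pose q x := if `[< V x >] then p x else 0.
have qE x : V x -> q x = p x by move=> Vx; rewrite /q asboolT.
have q0 x : 0 <= q x by rewrite /q; case: asboolP => // /p0.
apply: (DSC_on_eq _ q) => //; exists (lipschitz_minorant q); split.
- exact: lipschitz_minorant_continuous.
- move=> x Vx; apply: lipschitz_minorant_cvg => // c.
  rewrite qE // => /(lsc x Vx); apply: filterS2 (oV x Vx) => y Vy.
  by rewrite qE.
- move=> x _; apply: (is_cvg_series_bounded _ (q x)) => // n.
  rewrite /series /= (eq_bigr (fun i =>
    lipschitz_minorant q i.+1 x - lipschitz_minorant q i x)); last first.
    move=> i _; rewrite ger0_norm // subr_ge0.
    exact: lipschitz_minorant_nondecreasing.
  rewrite telescope_sumr //.
  have := lipschitz_minorant_ge0 _ q0 0 x.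
  by have := lipschitz_minorant_le_self _ q0 n x; lra.
Qed.

(** A countable base made of cozero sets, written [{b n > 0}] with [b n]
    continuous; here these are the balls of radius [1 / (m + 1)] centered in [D],
    and [b n] may be negative outside of them. *)
Lemma separable_cozero_base (D : set K) : countable D -> dense D ->
  exists b : nat -> K -> R, (forall n, continuous (b n)) /\
    forall (x : K) (A : set K), nbhs x A ->
      exists2 n, 0 < b n x & [set y | 0 < b n y] `<=` A.
Proof.
move=> /countable_injP[f finj] dD.
(* Pairs [(f c, m)] encode the ball of radius [1 / (m + 1)] around [c]; the
   function of a pair that encodes no ball is [0]. *)
pose center (m : nat) (c : K) := D c /\ f c = m.
pose b (mn : nat * nat) (x : K) : R :=
  match pselect (exists c, center mn.1 c) with
  | left ex => mn.2.+1%:R^-1 - d (sval (cid ex)) x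
  | right _ => 0
  end.
have bE c n x : D c -> b (f c, n) x = n.+1%:R^-1 - d c x.
  move=> Dc; rewrite /b; case: pselect => [ex|[]]; last by exists c.
  case: cid => c' /= [Dc' fc']; congr (_ - d _ _).
  by apply: finj; rewrite ?inE.
have cb mn : continuous (b mn).
  apply: (@dist_lipschitz_continuous _ 1) => // x y; rewrite /b mul1r.
  case: pselect => [ex|_]; last by rewrite add0r dist_ge0.
  rewrite -addrA lerD2l lerNl opprD opprK lerBlDr.
  exact: d_triangle.
exists (fun n => if unpickle n is Some mn then b mn else fun=> 0); split.
  by move=> n; case: unpickle => [mn|] //; move=> x; exact: cvg_cst.
move=> x A /d_nbhs[e e0 eA].
have [n ne] : exists n, n.+1%:R^-1 < e / 2.
  have [n _ nP] := near_infty_natSinv_lt (PosNum (divr_gt0 e0 (ltr0n R 2))).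
  by exists n; apply: nP => /=.
have : nbhs x [set y | d x y < n.+1%:R^-1].
  by apply/d_nbhs; exists n.+1%:R^-1; rewrite ?invr_gt0.
rewrite nbhsE => -[U [oU Ux] UA].
have [c [Uc Dc]] := dD U (ex_intro _ x Ux) oU.
exists (pickle (f c, n)); rewrite pickleK.
  by rewrite bE // subr_gt0 d_sym; exact: UA.
move=> y /=; rewrite bE // subr_gt0 => cy; apply: eA => /=.
have xc : d x c < n.+1%:R^-1 := UA _ Uc.
apply: le_lt_trans (d_triangle x c y) _; rewrite [e]splitr.
by rewrite ltrD ?(lt_trans _ ne).
Qed.

End Metric.

(** * Patching local approximations *)

(** If [f] is in [DSC_on] each member of a countable cover by cozero sets
    [{b n > 0}], then [f] is in [DSC].  Let [c n m] be [m * b n] truncated to the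
    interval from [0] to [1]; it increases to the indicator of [{b n > 0}] as [m]
    grows.  If [H n m] are the approximants on [{b n > 0}], then the [m]-th global
    approximant is the sum over [n < m] of
      (prod_(i < n) (1 - c i m)) * c n m * H n m.
    At a given point, for [m] large, only the term of the first [n] such that
    [b n > 0] remains, with coefficient [1]. *)
Lemma DSC_cozero_cover {R : realType} {K : topologicalType} (f : K -> R)
    (b : nat -> K -> R) :
  (forall n, continuous (b n)) -> (forall x, exists n, 0 < b n x) ->
  (forall n, DSC_on [set x | 0 < b n x] f) -> DSC f.
Proof.
move=> cb bcover /choice[H HP].
pose c (n m : nat) (x : K) : R := Num.max 0 (Num.min 1 (m%:R * b n x)).
have cc n m : continuous (c n m).
  move=> x; apply: (@continuous_max _ _ (cst 0)
    (fun x => Num.min 1 (m%:R * b n x))); first exact: cvg_cst.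
  apply: (@continuous_min _ _ (cst 1) (fun x => m%:R * b n x)).
    exact: cvg_cst.
  by apply: cvgMr; exact: cb.
pose F (m : nat) (x : K) : R :=
  \sum_(0 <= n < m) (\prod_(0 <= i < n) (1 - c i m x)) * c n m x * H n m x.
have FE x : exists n N, 0 < b n x /\ forall m, (N <= m)%N -> F m x = H n m x.
  have /ex_minnP[n bn nmin] := bcover x.
  have cl i m : (i < n)%N -> c i m x = 0.
    move=> lin; have bi : b i x <= 0.
      by rewrite leNgt; apply/negP => /nmin; rewrite leqNgt lin.
    apply/max_idPl; rewrite ge_min; apply/orP; right.
    by rewrite mulr_ge0_le0.
  have [M _ MP] := nbhs_infty_ger (b n x)^-1.
  exists n, (maxn n.+1 M); split=> // m; rewrite geq_max => /andP[nm Mm].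
  have c1 : c n m x = 1.
    have := MP m Mm; rewrite /= -[_^-1]div1r ler_pdivrMr // => le1.
    by rewrite /c (min_idPl le1) (max_idPr ler01).
  (* The factor [1 - c n m x] kills the terms after the [n]-th. *)
  have prod0 i : (n < i)%N -> \prod_(0 <= k < i) (1 - c k m x) = 0.
    move=> ni; rewrite (big_cat_nat (leq0n n) (ltnW ni)) (big_ltn ni) /=.
    by rewrite c1 subrr mul0r mulr0.
  rewrite /F (big_cat_nat (leq0n n) (ltnW nm)) (big_ltn nm) /=.
  rewrite [X in X + _]big_nat [X in X + _]big1 ?add0r; last first.
    by move=> i lin; rewrite cl // mulr0 mul0r.
  rewrite [X in _ + X]big_nat [X in _ + X]big1 ?addr0; last first.
    by move=> i /andP[ni _]; rewrite prod0 // !mul0r.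
  rewrite c1 mulr1 big_nat big1 ?mul1r // => i /andP[_ lin].
  by rewrite cl // subr0.
exists F; split.
- move=> m; apply: continuous_big => [|n _ x]; first exact: add_continuous.
  apply: cvgM; last by case: (HP n) => cH _ _; exact: cH.
  apply: cvgM; last exact: cc.
  apply: continuous_big => [|i _ y]; first exact: mul_continuous.
  by apply: cvgB; [exact: cvg_cst|exact: cc].
- move=> x; have [n [N [bn FH]]] := FE x; have [_ Hf _] := HP n.
  apply: cvg_trans (Hf x bn); apply: near_eq_cvg.
  by exists N => // m /= Nm; rewrite FH.
- move=> x; have [n [N [bn FH]]] := FE x; have [_ _ Hs] := HP n.
  apply: (eq_from_is_cvg_series _ _ N _ (Hs x bn)).
  by move=> m Nm; rewrite !FH // ltnW.
Qed.

(** On a space with a countable base of cozero sets, membership in [DSC] is a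
    local property. *)
Lemma DSC_local {R : realType} {K : topologicalType} (f : K -> R)
    (b : nat -> K -> R) :
  (forall n, continuous (b n)) ->
  (forall (x : K) (A : set K), nbhs x A ->
     exists2 n, 0 < b n x & [set y | 0 < b n y] `<=` A) ->
  (forall x : K, exists2 V : set K, nbhs x V & DSC_on V f) -> DSC f.
Proof.
move=> cb base loc.
(* The base sets on which [f] is not known to be in the class are made empty by
   replacing their function by [-1]. *)
pose good n := `[< DSC_on [set x | 0 < b n x] f >].
apply: (DSC_cozero_cover f (fun n x => if good n then b n x else -1)).
- by move=> n; case: good => //; move=> x; exact: cvg_cst.
- move=> x; have [V xV [F [cF Ff FV]]] := loc x.
  have [n bn nV] := base x V xV; exists n; rewrite ifT //; apply/asboolP.
  by exists F; split=> // k kn; [apply: Ff|apply: FV]; exact: nV.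
- move=> n; rewrite /good; case: asboolP => // _.
  apply: DSC_on_eq (DSC_on_cst _ 0) => k.
  by rewrite /= oppr_gt0 ltr10.
Qed.

(** * Sums of functions with an oscillation bound *)

Section OscillationBound.
Context {R : realType} {K : topologicalType}.

(** [G] dominates the oscillation of [S] at [x]; then [G + S] and [G - S] are
    both upper semicontinuous at [x]. *)
Definition osc_bound (G S : K -> R) (x : K) : Prop :=
  forall e, 0 < e -> \forall y \near x, G y + `|S y - S x| < G x + e.

Lemma osc_boundD (G1 S1 G2 S2 : K -> R) x :
  osc_bound G1 S1 x -> osc_bound G2 S2 x ->
  osc_bound (fun y => G1 y + G2 y) (fun y => S1 y + S2 y) x.
Proof.
move=> b1 b2 e e0; have e2 : 0 < e / 2 by rewrite divr_gt0.
apply: filterS2 (b1 _ e2) (b2 _ e2) => y h1 h2.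
have := ler_normD (S1 y - S1 x) (S2 y - S2 x).
by rewrite addrACA -opprD; lra.
Qed.

Lemma osc_bound_sum (g s : nat -> K -> R) (m n : nat) x :
  (forall j, (m <= j)%N -> osc_bound (g j) (s j) x) ->
  osc_bound (fun y => \sum_(m <= j < n) g j y)
            (fun y => \sum_(m <= j < n) s j y) x.
Proof.
move=> b; elim: n => [|n IH].
  move=> e e0; apply: nearW => y; rewrite !big_geq //.
  by rewrite subrr normr0 !add0r.
have [mn|nm] := leqP m n; last first.
  move=> e e0; apply: nearW => y; rewrite !big_geq //.
  by rewrite subrr normr0 !add0r.
move=> e e0; apply: filterS (osc_boundD _ _ _ _ _ IH (b n mn) e e0) => y /=.
by rewrite !big_nat_recr.
Qed.

Lemma osc_bound_uniform_limit (G S : K -> R) (V : set K) x :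
  nbhs x V ->
  (forall e, 0 < e -> exists G' S', osc_bound G' S' x /\
     forall y, V y -> `|G y - G' y| < e /\ `|S y - S' y| < e) ->
  osc_bound G S x.
Proof.
move=> xV appr e e0.
(* The error [e / 5] occurs five times: in replacing [G] and [S] by [G'] and [S']
   at [x] and at [y], and in the bound for [G'] and [S']. *)
have e5 : 0 < e / 5 by rewrite divr_gt0.
have [G' [S' [b GS]]] := appr _ e5.
have [Gx Sx] := GS x (nbhs_singleton xV).
apply: filterS2 xV (b _ e5) => y Vy; have [Gy Sy] := GS y Vy.
have := ler_distD (S' y) (S y) (S x); have := ler_distD (S' x) (S' y) (S x).
rewrite (distrC (S' x) (S x)); move: Gx Gy; rewrite !ltr_norml.
by move=> /andP[? ?] /andP[? ?]; lra.
Qed.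

End OscillationBound.

(** With an oscillation bound [G] for [S] near [x], the functions
    [M - (G + S)] and [M - (G - S)] are lower semicontinuous and, for suitable
    [M], nonnegative near [x]; half their difference is [S]. *)
Lemma osc_bound_DSC_on {R : realType} {K : topologicalType} (d : K -> K -> R)
  (d_eq0 : forall x y, d x y = 0 <-> x = y)
  (d_sym : forall x y, d x y = d y x)
  (d_triangle : forall x y z, d x z <= d x y + d y z)
  (d_nbhs : forall (x : K) (A : set K),
    nbhs x A <-> exists2 e : R, 0 < e & [set y | d x y < e] `<=` A)
  (G S : K -> R) (U : set K) (x : K) :
  nbhs x U -> (forall y, U y -> osc_bound G S y) ->
  exists V, [/\ nbhs x V, V `<=` U & DSC_on V S].
Proof.
move=> xU b; pose M := G x + 1 + `|S x|.
have : nbhs x (U `&` [set y | G y + `|S y - S x| < G x + 1]).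
  by apply: (filterI xU); exact: b (nbhs_singleton xU) _ ltr01.
rewrite {1}nbhsE => -[V [oV Vx] VU].
have nV y : V y -> nbhs y V by move=> Vy; exact: open_nbhs_nbhs.
exists V; split; [exact: nV|by move=> y /VU[]|].
have lsc (t : R) : `|t| = 1 -> DSC_on V (fun y => M - (G y + t * S y)).
  move=> t1; apply: (lsc_DSC_on d d_eq0 d_sym d_triangle d_nbhs) => // y Vy.
    have [_ /= Gy] := VU y Vy; rewrite subr_ge0 /M.
    have tS : t * S y <= `|S y|.
      by rewrite (le_trans (ler_norm _)) // normrM t1 mul1r.
    have := ler_normD (S y - S x) (S x); rewrite subrK; lra.
  move=> c cy; have e0 : 0 < M - (G y + t * S y) - c by rewrite subr_gt0.
  apply: filterS (b y (VU y Vy).1 _ e0) => z.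
  have : t * (S z - S y) <= `|S z - S y|.
    by rewrite (le_trans (ler_norm _)) // normrM t1 mul1r.
  by rewrite mulrBr; lra.
have Sp := lsc 1 (normr1 _); have Sm := lsc (-1) (normrN1 _).
apply: DSC_on_eq (DSC_onZ _ (2^-1) _ (DSC_onD _ _ _ Sm (DSC_onN _ _ Sp))).
by move=> y _; lra.
Qed.

(** The tails of a locally uniformly convergent series are, near each point and
    from some rank on, uniformly convergent series of real functions. *)
Lemma locally_uniformly_convergent_tail {R : realType} {K : topologicalType}
    (g : nat -> K -> \bar R) (x : K) : locally_uniformly_convergent g ->
  exists (U : set K) (nu : nat), [/\ nbhs x U,
    (forall j y, (nu <= j)%N -> U y -> g j y \is a fin_num) &
    forall N, (nu <= N)%N -> exists s : K -> R,
      forall e, 0 < e -> exists M, forall n, (M <= n)%N -> forall y, U y ->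
        `|s y - \sum_(N <= j < n) fine (g j y)| < e].
Proof.
move=> /(_ x)[U [nu [xU gfin [s gs]]]]; exists U, nu; split=> // N nuN.
exists (fun y => s y - \sum_(nu <= j < N) fine (g j y)) => e e0.
have [M _ MP] : \forall n \near \oo, forall y, U y ->
    `|s y - \sum_(nu <= j < n) fine (g j y)| < e.
  apply: (gs [set h | forall y, U y -> `|s y - h y| < e]).
  apply/uniform_nbhs; exists [set uv | `|uv.1 - uv.2| < e]; split.
    by rewrite -entourage_ballE; exists e.
  by move=> h.
exists (maxn N M) => n; rewrite geq_max => /andP[Nn Mn] y Uy.
rewrite -addrA -opprD -big_cat_nat //; exact: MP.
Qed.

(** Termwise oscillation bounds of two uniformly convergent series pass to
    their sums. *)
Lemma osc_bound_series {R : realType} {K : topologicalType}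
    (g s : nat -> K -> R) (G S : K -> R) (N : nat) (U : set K) (x : K) :
  nbhs x U -> (forall j, (N <= j)%N -> osc_bound (g j) (s j) x) ->
  (forall e, 0 < e -> exists M, forall n, (M <= n)%N -> forall y, U y ->
     `|G y - \sum_(N <= j < n) g j y| < e) ->
  (forall e, 0 < e -> exists M, forall n, (M <= n)%N -> forall y, U y ->
     `|S y - \sum_(N <= j < n) s j y| < e) ->
  osc_bound G S x.
Proof.
move=> xU b GM SM; apply: (osc_bound_uniform_limit _ _ U) => // e e0.
have [M1 MP1] := GM e e0; have [M2 MP2] := SM e e0.
exists (fun y => \sum_(N <= j < maxn M1 M2) g j y).
exists (fun y => \sum_(N <= j < maxn M1 M2) s j y).
split; first exact: osc_bound_sum.
by move=> y Uy; split; [apply: MP1|apply: MP2]; rewrite // ?leq_maxl ?leq_maxr.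
Qed.

Theorem corollary5p4 (R : realType) (K : topologicalType) (hK : polish R K)
    (phi : nat -> K -> R) (hphi : forall j : nat, DSC (phi j)) (f : K -> R)
    (hi : locally_uniformly_convergent (fun j x => (phi j x)%:E) /\
          forall x : K, series (fun j => phi j x) @ \oo --> f x)
    (hii : forall (W : eqType) (le : rel W) (wo : well_order le) (alpha : W),
        countable [set beta | wlt le beta alpha] ->
        locally_uniformly_convergent (fun j => osc wo (phi j) alpha)) :
  DSC f.
Proof.
have [d [[d_eq0 d_sym d_triangle] d_nbhs _ [D cD dD]]] := hK.
have [b [cb base]] :=
  separable_cozero_base d d_eq0 d_sym d_triangle d_nbhs D cD dD.
have [le wo] := well_ordering_principle (set nat).
have [g cg gstat] : exists2 g, countable_ordinal (le := le) g &
    forall s, countable_ordinal (le := le) s -> le g s ->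
    forall j x, osc wo (phi j) s x = osc wo (phi j) g x.
  apply: (osc_stationary wo phi (fun n => [set y | 0 < b n y])) => //.
    move=> x A /base[n bn nA]; exists n => //.
    exact: (cvgr_gt _ (cb n x) _ bn).
  exact: set_nat_uncountable.
have [s cs gs] := countable_ordinal_succ wo set_nat_uncountable g cg.
have stat j x := gstat s cs (wlt_le _ _ gs.1) j x.
apply: (DSC_local f b) => // x.
have [U1 [nu1 [xU1 _ tail1]]] := locally_uniformly_convergent_tail _ x hi.1.
have oscg_cvg : locally_uniformly_convergent (fun j => osc wo (phi j) g).
  apply: hii; apply: sub_countable cg; apply: subset_card_le => a /=.
  exact: wlt_le.
have [U2 [nu2 [xU2 fin2 tail2]]] :=
  locally_uniformly_convergent_tail _ x oscg_cvg.
pose N := maxn nu1 nu2.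
have [S SP] := tail1 N (leq_maxl _ _); have [G GP] := tail2 N (leq_maxr _ _).
pose U := interior (U1 `&` U2).
have nU y : U y -> nbhs y U by move=> Uy; exact: nbhs_interior.
have UU y : U y -> U1 y /\ U2 y by move=> /interior_subset.
have term j y : (N <= j)%N -> U y ->
    osc_bound (fun z => fine (osc wo (phi j) g z)) (phi j) y.
  move=> Nj Uy e e0; have nuj := leq_trans (leq_maxr nu1 nu2) Nj.
  have lt : (osc wo (phi j) g y < (fine (osc wo (phi j) g y) + e)%:E)%E.
    by rewrite EFinD fineK ?lteDl ?lte_fin //; exact: fin2 (UU y Uy).2.
  have := osc_stationary_usc wo (phi j) g s y _ gs (stat j y) lt.
  apply: filterS2 (nU y Uy) => z Uz.
  have fz := fin2 j z nuj (UU z Uz).2.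
  by rewrite -[X in (_ + X)%E](fineK fz) -EFinD lte_fin addrC.
have SGb y : U y -> osc_bound G S y.
  move=> Uy; apply: (osc_bound_series
    (fun j z => fine (osc wo (phi j) g z)) phi G S N U y).
  - exact: nU.
  - by move=> j Nj; exact: term.
  - move=> e /GP[M MP]; exists M => n Mn z /UU[_ Uz].
    exact: MP n Mn z Uz.
  - move=> e /SP[M MP]; exists M => n Mn z /UU[Uz _].
    exact: MP n Mn z Uz.
have xU : nbhs x U by apply: nbhs_interior; exact: filterI.
have [V [xV VU SV]] := osc_bound_DSC_on d d_eq0 d_sym d_triangle d_nbhs G S U x
  xU SGb.
exists V => //.
(* On [V], [f] is the sum of [phi j] over [j < N] plus the tail [S]. *)
have phiV := DSC_on_sum V phi N (fun j => DSC_DSC_on V _ (hphi j)).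
have := DSC_onD _ _ _ phiV SV.
apply: DSC_on_eq => y Vy; have [U1y _] := UU y (VU y Vy).
apply: (cvg_unique _ _ (hi.2 y)) => //.
apply/cvgrPdist_lt => e /SP[M MP]; exists (maxn N M) => // n /=.
rewrite geq_max => /andP[Nn Mn]; rewrite seriesEnat /=.
rewrite (big_cat_nat (leq0n N) Nn) /= opprD addrACA subrr add0r.
exact: MP.
Qed.
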